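(* If $\mathbf{A}$ is a (small) category and $Y$ is a simplicial set, then the horizontal categorification of the simplicial category $\sigma\mathbf{A}\times\nu Y$ is $\mathbf{A}\boxtimes cY$, i.e. $c_h(\sigma\mathbf{A}\times\nu Y)\cong\mathbf{A}\boxtimes cY$, where $cY$ is the traditional categorification (fundamental category) of $Y$.
   Context: A small double category $\mathbb{D}$ is an internal category in $\mathbf{Cat}$: it consists of a category $\mathbb{D}_0$ (objects and vertical morphisms), a category $\mathbb{D}_1$ (horizontal morphisms and squares, composed vertically), and source, target, unit and horizontal composition functors. $\mathbf{DblCat}$ is the category of small double categories and double functors. The horizontal nerve $N_h:\mathbf{DblCat}\to\mathbf{Cat}^{\Delta^{op}}$ has $(N_h\mathbb{D})_0=\mathbb{D}_0$, $(N_h\mathbb{D})_1=\mathbb{D}_1$, and $(N_h\mathbb{D})_n=\mathbb{D}_1\times_{\mathbb{D}_0}\cdots\times_{\mathbb{D}_0}\mathbb{D}_1$ ($n$ copies). Horizontal categorification $c_h:\mathbf{Cat}^{\Delta^{op}}\to\mathbf{DblCat}$ is the left adjoint of $N_h$. The functor $c:\mathbf{SSet}\to\mathbf{Cat}$ is the left adjoint of the usual nerve. $\sigma:\mathbf{Cat}\to\mathbf{Cat}^{\Delta^{op}}$ is the constant simplicial object functor, and $\nu:\mathbf{Set}^{\Delta^{op}}\to\mathbf{Cat}^{\Delta^{op}}$ regards each set as a discrete category levelwise. The external product $\mathbf{A}\boxtimes\mathbf{B}$ of categories is the double category with objects $\mathrm{Obj}\,\mathbf{A}\times\mathrm{Obj}\,\mathbf{B}$,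 vertical morphisms $(f,B)$ for $f$ in $\mathbf{A}$, horizontal morphisms $(A,g)$ for $g$ in $\mathbf{B}$, and exactly one square for each pair $(f:A\to A',\,g:B\to B')$ (with left side $(f,B)$, right side $(f,B')$, top $(A,g)$, bottom $(A',g)$). *)

(* Defs.v *)
From mathcomp Require Import all_boot.
From Stdlib Require Import FunctionalExtensionality ProofIrrelevance.

Set Implicit Arguments.
Unset Strict Implicit.
Unset Printing Implicit Defensive.

(* All compositions, in every kind of category below, are written in
   diagrammatic order: first the left argument, then the right one. *)

Record category := Category {
  obj : Type;
  hom : obj -> obj -> Type;
  idm : forall X, hom X X;
  comp : forall X Y Z, hom X Y -> hom Y Z -> hom X Z;
  comp1m : forall X Y (f : hom X Y), comp (idm X) f = f;
  compm1 : forall X Y (f : hom X Y), comp f (idm Y) = f;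
  compA : forall X Y Z W (f : hom X Y) (g : hom Y Z) (h : hom Z W),
    comp (comp f g) h = comp f (comp g h)
}.
Arguments hom {c} X Y.
Arguments idm {c} X.
Arguments comp {c X Y Z} f g.

Record functor (C D : category) := Functor {
  fobj :> obj C -> obj D;
  fhom : forall X Y, hom X Y -> hom (fobj X) (fobj Y);
  fhom1 : forall X, fhom (idm X) = idm (fobj X);
  fhomM : forall X Y Z (f : hom X Y) (g : hom Y Z),
    fhom (comp f g) = comp (fhom f) (fhom g)
}.
Arguments fhom {C D} F {X Y} _ : rename.

Record nattrans (C D : category) (F G : functor C D) := NatTrans {
  ntc :> forall X, hom (F X) (G X);
  ntP : forall X Y (f : hom X Y),
    comp (fhom F f) (ntc Y) = comp (ntc X) (fhom G f)
}.

Lemma nattrans_eq (C D : category) (F G : functor C D) (s t : nattrans F G) :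
  (forall X, s X = t X) -> s = t.
Proof.
case: s t => [s sP] [t tP] /= st.
have e : s = t by apply: functional_extensionality_dep.
by subst t; congr NatTrans; apply: proof_irrelevance.
Qed.

Definition nattrans_id (C D : category) (F : functor C D) : nattrans F F.
Proof.
exists (fun X => idm (F X)).
by move=> X Y f; rewrite compm1 comp1m.
Defined.

Definition nattrans_comp (C D : category) (F G H : functor C D)
  (s : nattrans F G) (t : nattrans G H) : nattrans F H.
Proof.
exists (fun X => comp (s X) (t X)).
by move=> X Y f; rewrite -compA ntP compA ntP compA.
Defined.

Definition functor_category (C D : category) : category.
Proof.
refine (@Category (functor C D) (@nattrans C D) (@nattrans_id C D)
          (@nattrans_comp C D) _ _ _).
- by move=> F G s; apply: nattrans_eq => X; apply: comp1m.
- by move=> F G s; apply: nattrans_eq => X; apply: compm1.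
- by move=> F G H K s t u; apply: nattrans_eq => X; apply: compA.
Defined.

Definition opposite (C : category) : category.
Proof.
refine (@Category (obj C) (fun X Y => hom Y X) (fun X => idm X)
          (fun X Y Z f g => comp g f) _ _ _).
- by move=> X Y f; apply: compm1.
- by move=> X Y f; apply: comp1m.
- by move=> X Y Z W f g h; rewrite compA.
Defined.

Definition isomorphic (C : category) (X Y : obj C) : Prop :=
  exists (f : hom X Y) (g : hom Y X), comp f g = idm X /\ comp g f = idm Y.

Record adjunction (C D : category) (L : functor C D) (R : functor D C) :=
  Adjunction {
  transpose : forall X Y, hom (L X) Y -> hom X (R Y);
  untranspose : forall X Y, hom X (R Y) -> hom (L X) Y;
  transposeK : forall X Y, cancel (@transpose X Y) (@untranspose X Y);
  untransposeK : forall X Y, cancel (@untranspose X Y) (@transpose X Y);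
  transpose_natl : forall X X' Y (f : hom X X') (g : hom (L X') Y),
    transpose (comp (fhom L f) g) = comp f (transpose g);
  transpose_natr : forall X Y Y' (g : hom (L X) Y) (h : hom Y Y'),
    transpose (comp g h) = comp (transpose g) (fhom R h)
}.

(* Type here is one fixed universe; the definitions of nerve and nu below force
   it to be the universe of the objects and morphisms of small categories. *)
Definition Sets : category.
Proof.
by refine (@Category Type (fun X Y => X -> Y) (fun X x => x)
             (fun X Y Z f g x => g (f x)) _ _ _).
Defined.

(* The object n stands for the ordinal [n] = {0 < ... < n}. *)
Definition monotone (m n : nat) :=
  {f : 'I_m.+1 -> 'I_n.+1 | forall i j : 'I_m.+1, i <= j -> f i <= f j}.

Lemma monotone_eq m n (f g : monotone m n) : sval f = sval g -> f = g.
Proof.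
case: f g => [f fP] [g gP] /= e; subst g.
by congr exist; apply: proof_irrelevance.
Qed.

Definition monotone_id n : monotone n n :=
  exist (fun f : 'I_n.+1 -> 'I_n.+1 => forall i j : 'I_n.+1, i <= j -> f i <= f j)
    (fun i => i) (fun i j le => le).

Definition monotone_comp m n p (f : monotone m n) (g : monotone n p) :
  monotone m p :=
  exist (fun h : 'I_m.+1 -> 'I_p.+1 => forall i j : 'I_m.+1, i <= j -> h i <= h j)
    (fun i => sval g (sval f i))
    (fun i j le => svalP g _ _ (svalP f _ _ le)).

Definition Delta : category.
Proof.
by refine (@Category nat monotone monotone_id monotone_comp _ _ _);
  intros; apply: monotone_eq.
Defined.

Definition simplicial (C : category) : category :=
  functor_category (opposite Delta) C.

Definition SSet : category := simplicial Sets.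

(* Small categories are presented with a single type of morphisms, i.e. as
   internal categories in Sets.  Equality of functors is then equality of two
   plain functions, and the strict identities between objects demanded by
   internal categories in Cat involve no transport. *)
Record smallcat := SmallCat {
  ob : Type;
  mor : Type;
  dom : mor -> ob;
  cod : mor -> ob;
  one : ob -> mor;
  scomp : forall f g, cod f = dom g -> mor;
  dom_one : forall x, dom (one x) = x;
  cod_one : forall x, cod (one x) = x;
  dom_scomp : forall f g (e : cod f = dom g), dom (scomp e) = dom f;
  cod_scomp : forall f g (e : cod f = dom g), cod (scomp e) = cod g;
  scomp1m : forall f (e : cod (one (dom f)) = dom f), scomp e = f;
  scompm1 : forall f (e : cod f = dom (one (cod f))), scomp e = f;
  scompA : forall f g h (efg : cod f = dom g) (egh : cod g = dom h)
    (el : cod (scomp efg) = dom h) (er : cod f = dom (scomp egh)),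
    scomp el = scomp er
}.
Arguments dom {s} f.
Arguments cod {s} f.
Arguments one {s} x.
Arguments scomp {s} f g e.

Lemma scomp_eq (C : smallcat) (f f' g g' : mor C) e e' :
  f = f' -> g = g' -> scomp f g e = scomp f' g' e'.
Proof.
by move=> ef eg; subst f' g'; congr scomp; apply: proof_irrelevance.
Qed.

Record sfunctor (A B : smallcat) := SFunctor {
  fob :> ob A -> ob B;
  fmor : mor A -> mor B;
  fdom : forall f, dom (fmor f) = fob (dom f);
  fcod : forall f, cod (fmor f) = fob (cod f);
  fone : forall x, fmor (one x) = one (fob x);
  fscomp : forall f g e e', fmor (scomp f g e) = scomp (fmor f) (fmor g) e'
}.

Arguments fscomp {A B} s {f g} e e'.

Lemma sfunctor_eq (A B : smallcat) (F G : sfunctor A B) :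
  fob F =1 fob G -> fmor F =1 fmor G -> F = G.
Proof.
case: F G => [F0 F1 a b c d] [G0 G1 a' b' c' d'] /= e0 e1.
have ? : F0 = G0 by apply: functional_extensionality.
have ? : F1 = G1 by apply: functional_extensionality.
by subst G0 G1; congr SFunctor; apply: proof_irrelevance.
Qed.

Definition sfunctor_id (A : smallcat) : sfunctor A A.
Proof.
refine (@SFunctor A A id id _ _ _ _) => // f g e e'; exact: scomp_eq.
Defined.

Definition sfunctor_comp (A B C : smallcat)
  (F : sfunctor A B) (G : sfunctor B C) : sfunctor A C.
Proof.
refine (@SFunctor A C (fun x => G (F x)) (fun f => fmor G (fmor F f)) _ _ _ _).
- by move=> f; rewrite !fdom.
- by move=> f; rewrite !fcod.
- by move=> f; rewrite !fone.
- move=> f g e e'; have e1 : cod (fmor F f) = dom (fmor F g).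
    by rewrite fcod fdom e.
  by rewrite (fscomp F e e1); apply: fscomp.
Defined.

Definition Cat : category.
Proof.
by refine (@Category smallcat sfunctor sfunctor_id sfunctor_comp _ _ _);
  intros; apply: sfunctor_eq.
Defined.

Definition SCat : category := simplicial Cat.

Lemma pair_val_eq (X Y : Type) (P : X * Y -> Prop) (p q : {z | P z}) :
  (sval p).1 = (sval q).1 -> (sval p).2 = (sval q).2 -> p = q.
Proof.
case: p q => [[a b] Pp] [[c d] Qq] /= ? ?; subst c d.
by congr exist; apply: proof_irrelevance.
Qed.

Section Pullback.
Variables (A B C : smallcat) (F : sfunctor A C) (G : sfunctor B C).

Definition pb_ob := {p : ob A * ob B | F p.1 = G p.2}.
Definition pb_mor := {p : mor A * mor B | fmor F p.1 = fmor G p.2}.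

Lemma pb_dom_subproof (p : pb_mor) :
  F (dom (sval p).1) = G (dom (sval p).2).
Proof. by rewrite -!fdom (svalP p). Qed.

Lemma pb_cod_subproof (p : pb_mor) :
  F (cod (sval p).1) = G (cod (sval p).2).
Proof. by rewrite -!fcod (svalP p). Qed.

Lemma pb_one_subproof (p : pb_ob) :
  fmor F (one (sval p).1) = fmor G (one (sval p).2).
Proof. by rewrite !fone (svalP p). Qed.

Definition pb_dom (p : pb_mor) : pb_ob :=
  exist _ (dom (sval p).1, dom (sval p).2) (pb_dom_subproof p).
Definition pb_cod (p : pb_mor) : pb_ob :=
  exist _ (cod (sval p).1, cod (sval p).2) (pb_cod_subproof p).
Definition pb_one (p : pb_ob) : pb_mor :=
  exist _ (one (sval p).1, one (sval p).2) (pb_one_subproof p).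

Lemma pb_eq1 (p q : pb_mor) :
  pb_cod p = pb_dom q -> cod (sval p).1 = dom (sval q).1.
Proof. by move=> /(congr1 (fun r => (sval r).1)). Qed.

Lemma pb_eq2 (p q : pb_mor) :
  pb_cod p = pb_dom q -> cod (sval p).2 = dom (sval q).2.
Proof. by move=> /(congr1 (fun r => (sval r).2)). Qed.

Lemma pb_scomp_subproof (p q : pb_mor) (e : pb_cod p = pb_dom q) :
  fmor F (scomp (sval p).1 (sval q).1 (pb_eq1 e)) =
  fmor G (scomp (sval p).2 (sval q).2 (pb_eq2 e)).
Proof.
have e1 : cod (fmor F (sval p).1) = dom (fmor F (sval q).1).
  by rewrite fcod fdom (pb_eq1 e).
have e2 : cod (fmor G (sval p).2) = dom (fmor G (sval q).2).
  by rewrite fcod fdom (pb_eq2 e).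
rewrite (fscomp F _ e1) (fscomp G _ e2); apply: scomp_eq.
  exact: (svalP p).
exact: (svalP q).
Qed.

Definition pb_scomp (p q : pb_mor) (e : pb_cod p = pb_dom q) : pb_mor :=
  exist _ (scomp (sval p).1 (sval q).1 (pb_eq1 e),
           scomp (sval p).2 (sval q).2 (pb_eq2 e)) (pb_scomp_subproof e).

Definition pullback : smallcat.
Proof.
refine (@SmallCat pb_ob pb_mor pb_dom pb_cod pb_one pb_scomp _ _ _ _ _ _ _).
- by move=> x; apply: pair_val_eq; apply: dom_one.
- by move=> x; apply: pair_val_eq; apply: cod_one.
- by move=> f g e; apply: pair_val_eq; apply: dom_scomp.
- by move=> f g e; apply: pair_val_eq; apply: cod_scomp.
- by move=> f e; apply: pair_val_eq; apply: scomp1m.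
- by move=> f e; apply: pair_val_eq; apply: scompm1.
- by move=> f g h efg egh el er; apply: pair_val_eq; apply: scompA.
Defined.

Definition pb_fst : sfunctor pullback A.
Proof.
refine (@SFunctor pullback A (fun p => (sval p).1) (fun p => (sval p).1)
          _ _ _ _) => //.
by move=> p q e e'; apply: scomp_eq.
Defined.

Definition pb_snd : sfunctor pullback B.
Proof.
refine (@SFunctor pullback B (fun p => (sval p).2) (fun p => (sval p).2)
          _ _ _ _) => //.
by move=> p q e e'; apply: scomp_eq.
Defined.

End Pullback.

Definition discrete (X : Type) : smallcat.
Proof.
by refine (@SmallCat X X id id id (fun x y _ => x) _ _ _ _ _ _ _).
Defined.

Definition discrete_map (X Y : Type) (f : X -> Y) :
  sfunctor (discrete X) (discrete Y).
Proof. by refine (@SFunctor (discrete X) (discrete Y) f f _ _ _ _). Defined.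

Section Product.
Variables (A B : smallcat).

Definition prod_scomp (f g : mor A * mor B)
    (e : (cod f.1, cod f.2) = (dom g.1, dom g.2)) : mor A * mor B :=
  (scomp f.1 g.1 (congr1 (@fst _ _) e), scomp f.2 g.2 (congr1 (@snd _ _) e)).

Definition product : smallcat.
Proof.
refine (@SmallCat (ob A * ob B) (mor A * mor B)
  (fun f => (dom f.1, dom f.2)) (fun f => (cod f.1, cod f.2))
  (fun x => (one x.1, one x.2)) prod_scomp _ _ _ _ _ _ _).
- by case=> x y /=; rewrite !dom_one.
- by case=> x y /=; rewrite !cod_one.
- by move=> f g e; rewrite /= !dom_scomp.
- by move=> f g e; rewrite /= !cod_scomp.
- by case=> f f' e; congr pair; apply: scomp1m.
- by case=> f f' e; congr pair; apply: scompm1.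
- by move=> f g h efg egh el er; congr pair; apply: scompA.
Defined.

End Product.

Definition product_map (A B A' B' : smallcat)
  (F : sfunctor A A') (G : sfunctor B B') :
  sfunctor (product A B) (product A' B').
Proof.
refine (@SFunctor (product A B) (product A' B')
  (fun x => (F x.1, G x.2)) (fun f => (fmor F f.1, fmor G f.2)) _ _ _ _).
- by move=> f; rewrite /= !fdom.
- by move=> f; rewrite /= !fcod.
- by move=> x; rewrite /= !fone.
- by move=> f g e e'; congr pair; apply: fscomp.
Defined.

Definition sigma (A : smallcat) : obj SCat.
Proof.
refine (@Functor (opposite Delta) Cat (fun _ => A)
          (fun _ _ _ => sfunctor_id A) _ _) => //.
by move=> *; apply: sfunctor_eq.
Defined.

Definition nu (Y : obj SSet) : obj SCat.
Proof.
refine (@Functor (opposite Delta) Cat (fun n => discrete (Y n))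
          (fun m n a => discrete_map (fhom Y a)) _ _).
- by move=> n; apply: sfunctor_eq => y /=; rewrite fhom1.
- by move=> m n p a b; apply: sfunctor_eq => y /=; rewrite fhomM.
Defined.

Definition sproduct (X Y : obj SCat) : obj SCat.
Proof.
refine (@Functor (opposite Delta) Cat (fun n => product (X n) (Y n))
          (fun m n a => product_map (fhom X a) (fhom Y a)) _ _).
- by move=> n; apply: sfunctor_eq; case=> u v /=; rewrite !fhom1.
- by move=> m n p a b; apply: sfunctor_eq; case=> u v /=; rewrite !fhomM.
Defined.

(* An internal category in Cat, with internal object d0 and internal arrows d1.
   hcomp_ob and hcomp_sq abbreviate the object and morphism parts of hcomp. *)
Record dblcat := DblCat_ {
  d0 : smallcat;
  d1 : smallcat;
  hsrc : sfunctor d1 d0;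
  htgt : sfunctor d1 d0;
  hunit : sfunctor d0 d1;
  hcomp : sfunctor (pullback htgt hsrc) d1;
  hcomp_ob := fun x y (e : htgt x = hsrc y) => hcomp (exist _ (x, y) e);
  hcomp_sq := fun s t (e : fmor htgt s = fmor hsrc t) =>
    fmor hcomp (exist _ (s, t) e);
  hsrc_unit : sfunctor_comp hunit hsrc = sfunctor_id d0;
  htgt_unit : sfunctor_comp hunit htgt = sfunctor_id d0;
  hsrc_comp_ob : forall x y e, hsrc (@hcomp_ob x y e) = hsrc x;
  hsrc_comp_sq : forall s t e,
    fmor hsrc (@hcomp_sq s t e) = fmor hsrc s;
  htgt_comp_ob : forall x y e, htgt (@hcomp_ob x y e) = htgt y;
  htgt_comp_sq : forall s t e,
    fmor htgt (@hcomp_sq s t e) = fmor htgt t;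
  hcomp1m_ob : forall x e, @hcomp_ob (hunit (hsrc x)) x e = x;
  hcomp1m_sq : forall s e, @hcomp_sq (fmor hunit (fmor hsrc s)) s e = s;
  hcompm1_ob : forall x e, @hcomp_ob x (hunit (htgt x)) e = x;
  hcompm1_sq : forall s e, @hcomp_sq s (fmor hunit (fmor htgt s)) e = s;
  hcompA_ob : forall x y z exy eyz el er,
    @hcomp_ob (@hcomp_ob x y exy) z el = @hcomp_ob x (@hcomp_ob y z eyz) er;
  hcompA_sq : forall s t u est etu el er,
    @hcomp_sq (@hcomp_sq s t est) u el = @hcomp_sq s (@hcomp_sq t u etu) er
}.
Arguments hsrc {d}.
Arguments htgt {d}.
Arguments hunit {d}.
Arguments hcomp {d}.
Arguments hcomp_ob {d} x y e.
Arguments hcomp_sq {d} s t e.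

Record dblfunctor (D E : dblcat) := DblFunctor {
  df0 : sfunctor (d0 D) (d0 E);
  df1 : sfunctor (d1 D) (d1 E);
  df_src : sfunctor_comp df1 hsrc = sfunctor_comp hsrc df0;
  df_tgt : sfunctor_comp df1 htgt = sfunctor_comp htgt df0;
  df_unit : sfunctor_comp hunit df1 = sfunctor_comp df0 hunit;
  df_comp_ob : forall x y e e',
    df1 (hcomp_ob x y e) = hcomp_ob (df1 x) (df1 y) e';
  df_comp_sq : forall s t e e',
    fmor df1 (hcomp_sq s t e) = hcomp_sq (fmor df1 s) (fmor df1 t) e'
}.

Arguments df_comp_ob {D E} d {x y} e e'.
Arguments df_comp_sq {D E} d {s t} e e'.

Lemma dblfunctor_eq (D E : dblcat) (F G : dblfunctor D E) :
  df0 F = df0 G -> df1 F = df1 G -> F = G.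
Proof.
case: F G => [F0 F1 a b c d e] [G0 G1 a' b' c' d' e'] /= ? ?.
by subst G0 G1; congr DblFunctor; apply: proof_irrelevance.
Qed.

Lemma hcomp_ob_eq (D : dblcat) (x x' y y' : ob (d1 D)) e e' :
  x = x' -> y = y' -> hcomp_ob x y e = hcomp_ob x' y' e'.
Proof.
by move=> ex ey; subst x' y'; congr hcomp_ob; apply: proof_irrelevance.
Qed.

Lemma hcomp_sq_eq (D : dblcat) (x x' y y' : mor (d1 D)) e e' :
  x = x' -> y = y' -> hcomp_sq x y e = hcomp_sq x' y' e'.
Proof.
by move=> ex ey; subst x' y'; congr hcomp_sq; apply: proof_irrelevance.
Qed.

Section DoubleFunctorTheory.
Variables (D E : dblcat) (F : dblfunctor D E).

Lemma df_src_ob x : hsrc (df1 F x) = df0 F (hsrc x).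
Proof. exact: (congr1 (fun H : sfunctor _ _ => H x) (df_src F)). Qed.
Lemma df_src_sq s : fmor hsrc (fmor (df1 F) s) = fmor (df0 F) (fmor hsrc s).
Proof. exact: (congr1 (fun H => fmor H s) (df_src F)). Qed.
Lemma df_tgt_ob x : htgt (df1 F x) = df0 F (htgt x).
Proof. exact: (congr1 (fun H : sfunctor _ _ => H x) (df_tgt F)). Qed.
Lemma df_tgt_sq s : fmor htgt (fmor (df1 F) s) = fmor (df0 F) (fmor htgt s).
Proof. exact: (congr1 (fun H => fmor H s) (df_tgt F)). Qed.
Lemma df_unit_ob x : df1 F (hunit x) = hunit (df0 F x).
Proof. exact: (congr1 (fun H : sfunctor _ _ => H x) (df_unit F)). Qed.
Lemma df_unit_sq s :
  fmor (df1 F) (fmor hunit s) = fmor hunit (fmor (df0 F) s).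
Proof. exact: (congr1 (fun H => fmor H s) (df_unit F)). Qed.

End DoubleFunctorTheory.

Section DoubleCategoryTheory.
Variable D : dblcat.

Lemma hsrc_unit_ob (x : ob (d0 D)) : hsrc (hunit x) = x.
Proof. exact: (congr1 (fun H : sfunctor _ _ => H x) (hsrc_unit D)). Qed.
Lemma hsrc_unit_sq (s : mor (d0 D)) : fmor hsrc (fmor hunit s) = s.
Proof. exact: (congr1 (fun H => fmor H s) (hsrc_unit D)). Qed.
Lemma htgt_unit_ob (x : ob (d0 D)) : htgt (hunit x) = x.
Proof. exact: (congr1 (fun H : sfunctor _ _ => H x) (htgt_unit D)). Qed.
Lemma htgt_unit_sq (s : mor (d0 D)) : fmor htgt (fmor hunit s) = s.
Proof. exact: (congr1 (fun H => fmor H s) (htgt_unit D)). Qed.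

End DoubleCategoryTheory.

Definition dblfunctor_id (D : dblcat) : dblfunctor D D.
Proof.
refine (@DblFunctor D D (sfunctor_id _) (sfunctor_id _) _ _ _ _ _);
  try exact: sfunctor_eq.
- by move=> x y e e'; apply: hcomp_ob_eq.
- by move=> x y e e'; apply: hcomp_sq_eq.
Defined.

Definition dblfunctor_comp (D E K : dblcat)
  (F : dblfunctor D E) (G : dblfunctor E K) : dblfunctor D K.
Proof.
refine (@DblFunctor D K (sfunctor_comp (df0 F) (df0 G))
          (sfunctor_comp (df1 F) (df1 G)) _ _ _ _ _).
- apply: sfunctor_eq => x /=; first by rewrite !df_src_ob.
  by rewrite !df_src_sq.
- apply: sfunctor_eq => x /=; first by rewrite !df_tgt_ob.
  by rewrite !df_tgt_sq.
- apply: sfunctor_eq => x /=; first by rewrite !df_unit_ob.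
  by rewrite !df_unit_sq.
- move=> x y e e' /=; have e1 : htgt (df1 F x) = hsrc (df1 F y).
    by rewrite df_tgt_ob e df_src_ob.
  by rewrite (df_comp_ob F _ e1); apply: df_comp_ob.
- move=> s t e e' /=.
  have e1 : fmor htgt (fmor (df1 F) s) = fmor hsrc (fmor (df1 F) t).
    by rewrite df_tgt_sq e df_src_sq.
  by rewrite (df_comp_sq F _ e1); apply: df_comp_sq.
Defined.

Definition DblCat : category.
Proof.
by refine (@Category dblcat dblfunctor dblfunctor_id dblfunctor_comp _ _ _);
  intros; apply: dblfunctor_eq; apply: sfunctor_eq.
Defined.

(* [chain C n] is the n-fold fibre product mor C x_{ob C} ... x_{ob C} mor C:
   the strings of n composable morphisms, recorded together with the n + 1
   objects they run through, so that [chain C 0] is ob C. *)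
Record chain (C : smallcat) (n : nat) := Chain {
  vtx : 'I_n.+1 -> ob C;
  edge : 'I_n -> mor C;
  dom_edge : forall i, dom (edge i) = vtx (widen_ord (leqnSn n) i);
  cod_edge : forall i, cod (edge i) = vtx (lift ord0 i)
}.

Lemma chain_eq (C : smallcat) n (x y : chain C n) :
  vtx x =1 vtx y -> edge x =1 edge y -> x = y.
Proof.
case: x y => [v e d c] [v' e' d' c'] /= ev ee.
have ? : v = v' by apply: functional_extensionality.
have ? : e = e' by apply: functional_extensionality.
by subst v' e'; congr Chain; apply: proof_irrelevance.
Qed.

Section Composite.
Variables (C : smallcat) (n : nat) (x : chain C n).

Definition spans (i : 'I_n.+1) (k : nat) (lt : i + k < n.+1) (f : mor C) :=
  dom f = vtx x i /\ cod f = vtx x (Ordinal lt).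

Lemma spans0 (i : 'I_n.+1) (lt : i + 0 < n.+1) : spans lt (one (vtx x i)).
Proof.
split; first exact: dom_one.
by rewrite cod_one; congr vtx; apply: val_inj; rewrite /= addn0.
Qed.

Lemma spans_lt (i k : nat) : i + k.+1 < n.+1 -> i + k < n.
Proof. by rewrite addnS ltnS. Qed.

Lemma spans_joint (i : 'I_n.+1) k (lt : i + k < n) f :
  spans (leqW lt) f -> cod f = dom (edge x (Ordinal lt)).
Proof. by case=> _ ->; rewrite dom_edge; congr vtx; apply: val_inj. Qed.

Lemma spansS (i : 'I_n.+1) k (lt : i + k.+1 < n.+1) f
    (Pf : spans (leqW (spans_lt lt)) f) :
  spans lt (scomp f (edge x (Ordinal (spans_lt lt))) (spans_joint Pf)).
Proof.
split; first by rewrite dom_scomp Pf.1.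
rewrite cod_scomp cod_edge; congr vtx; apply: val_inj.
by rewrite /= /bump /= add1n addnS.
Qed.

Fixpoint composite (i : 'I_n.+1) (k : nat) :
    forall lt : i + k < n.+1, {f : mor C | spans lt f} :=
  match k with
  | 0 => fun lt => exist _ (one (vtx x i)) (spans0 lt)
  | k.+1 => fun lt =>
      let f := composite (leqW (spans_lt lt)) in
      exist _ (scomp (sval f) (edge x (Ordinal (spans_lt lt)))
                     (spans_joint (svalP f)))
              (spansS (svalP f))
  end.

Lemma thru_subproof (i j : 'I_n.+1) : i <= j -> i + (j - i) < n.+1.
Proof. by move=> le; rewrite subnKC. Qed.

Definition thru (i j : 'I_n.+1) (le : i <= j) : mor C :=
  sval (composite (thru_subproof le)).

Lemma dom_thru (i j : 'I_n.+1) (le : i <= j) : dom (thru le) = vtx x i.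
Proof. exact: (svalP (composite _)).1. Qed.

Lemma cod_thru (i j : 'I_n.+1) (le : i <= j) : cod (thru le) = vtx x j.
Proof.
rewrite (svalP (composite (thru_subproof le))).2.
by congr vtx; apply: val_inj; rewrite /= subnKC.
Qed.

Lemma composite_eq (i : 'I_n.+1) k k' (lt : i + k < n.+1) (lt' : i + k' < n.+1) :
  k = k' -> sval (composite lt) = sval (composite lt').
Proof. by move=> e; subst k'; rewrite (proof_irrelevance _ lt lt'). Qed.

Lemma thru_refl (i : 'I_n.+1) (le : i <= i) : thru le = one (vtx x i).
Proof.
have lt : i + 0 < n.+1 by rewrite addn0.
by rewrite /thru (composite_eq _ lt (subnn i)).
Qed.

Lemma thru_step (i : 'I_n.+1) (j : 'I_n) (le : i <= lift ord0 j)
    (le' : i <= widen_ord (leqnSn n) j) e :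
  thru le = scomp (thru le') (edge x j) e.
Proof.
have ek : lift ord0 j - i = (j - i).+1 by rewrite /= /bump /= add1n subSn.
have lt : i + (j - i).+1 < n.+1 by rewrite addnS subnKC // ltnS.
rewrite /thru (composite_eq _ lt ek) /=; apply: scomp_eq.
  exact: composite_eq.
by congr edge; apply: val_inj; rewrite /= subnKC.
Qed.

End Composite.

Lemma thru_ind n (P : 'I_n.+1 -> 'I_n.+1 -> Prop) :
  (forall i, P i i) ->
  (forall (i : 'I_n.+1) (j : 'I_n), i <= widen_ord (leqnSn n) j ->
     P i (widen_ord (leqnSn n) j) -> P i (lift ord0 j)) ->
  forall i j : 'I_n.+1, i <= j -> P i j.
Proof.
move=> P1 PS i [j ltj] /=.
elim: j ltj => [|j IH] ltj.
  rewrite leqn0 => /eqP i0.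
  by have -> : Ordinal ltj = i by apply: val_inj.
rewrite leq_eqVlt => /orP [/eqP ij|]; first by
  have -> : Ordinal ltj = i by apply: val_inj.
rewrite ltnS => le; have ltj' : j < n by rewrite -ltnS.
have -> : Ordinal ltj = lift ord0 (Ordinal ltj') by apply: val_inj.
apply: PS => //=.
have -> : widen_ord (leqnSn n) (Ordinal ltj') = Ordinal (leqW ltj')
  by apply: val_inj.
exact: IH.
Qed.

Lemma thru_comp (C : smallcat) n (x : chain C n) (i j k : 'I_n.+1)
    (lij : i <= j) (ljk : j <= k) (lik : i <= k) e :
  thru x lik = scomp (thru x lij) (thru x ljk) e.
Proof.
move: j k ljk (ljk) i lij lik e.
apply: (thru_ind (P := fun j k => forall (ljk : j <= k) (i : 'I_n.+1)
  (lij : i <= j) (lik : i <= k) e,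
  thru x lik = scomp (thru x lij) (thru x ljk) e)).
- move=> j ljj i lij lik e; have ej := thru_refl x ljj.
  have e' : cod (thru x lij) = dom (one (cod (thru x lij)))
    by rewrite dom_one.
  rewrite (bool_irrelevance lik lij) -[LHS](scompm1 e').
  by apply: scomp_eq => //; rewrite ej cod_thru.
- move=> j k ljk IH ljk' i lij lik e.
  have lik' : i <= widen_ord (leqnSn n) k := leq_trans lij ljk.
  have c (l : 'I_n.+1) (le : l <= widen_ord (leqnSn n) k) :
    cod (thru x le) = dom (edge x k) by rewrite cod_thru dom_edge.
  rewrite (thru_step _ (c _ lik')).
  have e1 : cod (thru x lij) = dom (thru x ljk) by rewrite cod_thru dom_thru.
  have e2 : cod (thru x lij) = dom (scomp _ _ (c _ ljk)).
    by rewrite dom_scomp.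
  have e3 : cod (scomp _ _ e1) = dom (edge x k).
    by rewrite cod_scomp.
  transitivity (scomp _ _ e3).
    by apply: scomp_eq => //; apply: IH.
  rewrite (scompA e3 e2); apply: scomp_eq => //.
  by rewrite (thru_step _ (c _ ljk)).
Qed.

Lemma monotone_step m n (a : monotone m n) (i : 'I_m) :
  sval a (widen_ord (leqnSn m) i) <= sval a (lift ord0 i).
Proof. by apply: (svalP a); rewrite /= /bump /= leq_addl. Qed.

(* The simplicial operator a sends a chain to its vertices a(0), ..., a(m) and
   its composites from a(i) to a(i + 1). *)
Definition chain_act (C : smallcat) m n (a : monotone m n) (x : chain C n) :
  chain C m.
Proof.
exists (fun i => vtx x (sval a i)) (fun i => thru x (monotone_step a i)) => i.
  exact: dom_thru.
exact: cod_thru.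
Defined.

Lemma thru_act (C : smallcat) m n (a : monotone m n) (x : chain C n)
    (i j : 'I_m.+1) (le : i <= j) (le' : sval a i <= sval a j) :
  thru (chain_act a x) le = thru x le'.
Proof.
move: i j le (le) le'; apply: (thru_ind (P := fun i j => forall (le : i <= j)
  (le' : sval a i <= sval a j), thru (chain_act a x) le = thru x le')).
- by move=> i le le'; rewrite !thru_refl.
- move=> i j le IH leS le'.
  have lea : sval a i <= sval a (widen_ord (leqnSn m) j) := svalP a _ _ le.
  have e : cod (thru (chain_act a x) le) = dom (edge (chain_act a x) j).
    by rewrite cod_thru dom_edge.
  rewrite (thru_step _ e) /=.
  have les : sval a (widen_ord (leqnSn m) j) <= sval a (lift ord0 j).
    exact: monotone_step.
  have e' : cod (thru x lea) = dom (thru x les) by rewrite cod_thru dom_thru.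
  rewrite (thru_comp _ e'); apply: scomp_eq; first exact: IH.
  by rewrite (bool_irrelevance les (monotone_step a j)).
Qed.

Lemma chain_act_id (C : smallcat) n (x : chain C n) :
  chain_act (monotone_id n) x = x.
Proof.
apply: chain_eq => // i /=.
set le := (X in thru x X); move: le => /= le.
have e : cod (thru x (leqnn (widen_ord (leqnSn n) i))) = dom (edge x i).
  by rewrite cod_thru dom_edge.
rewrite (thru_step _ e).
have e' : cod (one (dom (edge x i))) = dom (edge x i) by rewrite cod_one.
rewrite -[RHS](scomp1m e'); apply: scomp_eq => //.
by rewrite thru_refl dom_edge.
Qed.

Lemma chain_act_comp (C : smallcat) m n p (a : monotone m n)
    (b : monotone n p) (x : chain C p) :
  chain_act (monotone_comp a b) x = chain_act a (chain_act b x).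
Proof.
apply: chain_eq => // i /=.
by apply: esym; apply: (@thru_act C n p b x).
Qed.

Definition chain_map (C D : smallcat) (F : sfunctor C D) {n} (x : chain C n) :
  chain D n.
Proof.
exists (fun i => F (vtx x i)) (fun i => fmor F (edge x i)) => i.
  by rewrite fdom dom_edge.
by rewrite fcod cod_edge.
Defined.

Lemma thru_map (C D : smallcat) (F : sfunctor C D) n (x : chain C n)
    (i j : 'I_n.+1) (le : i <= j) :
  thru (chain_map F x) le = fmor F (thru x le).
Proof.
move: i j le (le); apply: (thru_ind (P := fun i j => forall le : i <= j,
  thru (chain_map F x) le = fmor F (thru x le))).
- by move=> i le; rewrite !thru_refl fone.
- move=> i j le IH leS.
  have e0 : cod (thru (chain_map F x) le) = dom (edge (chain_map F x) j).
    by rewrite cod_thru dom_edge.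
  have e : cod (thru x le) = dom (edge x j) by rewrite cod_thru dom_edge.
  have e' : cod (fmor F (thru x le)) = dom (fmor F (edge x j)).
    by rewrite fcod fdom e.
  by rewrite (thru_step _ e0) (thru_step _ e) (fscomp F _ e'); apply: scomp_eq.
Qed.

Lemma chain_map_act (C D : smallcat) (F : sfunctor C D) m n
    (a : monotone m n) (x : chain C n) :
  chain_act a (chain_map F x) = chain_map F (chain_act a x).
Proof. by apply: chain_eq => // i; apply: thru_map. Qed.

Definition nerve_obj (C : smallcat) : obj SSet.
Proof.
refine (@Functor (opposite Delta) Sets (chain C)
          (fun n m a => chain_act a) _ _).
- by move=> n; apply: functional_extensionality => x; apply: chain_act_id.
- move=> m n p a b; apply: functional_extensionality => x.
  exact: chain_act_comp.
Defined.

Definition nerve_hom (C D : smallcat) (F : sfunctor C D) :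
  nattrans (nerve_obj C) (nerve_obj D).
Proof.
exists (fun n => @chain_map C D F n) => m n a.
by apply: functional_extensionality => x; rewrite /= chain_map_act.
Defined.

Definition nerve : functor Cat SSet.
Proof.
refine (@Functor Cat SSet nerve_obj nerve_hom _ _).
- move=> C; apply: nattrans_eq => n; apply: functional_extensionality => x.
  exact: chain_eq.
- move=> C D E F G; apply: nattrans_eq => n.
  by apply: functional_extensionality => x; apply: chain_eq.
Defined.

Section Transpose.
Variable D : dblcat.

(* The horizontal compositions make D a pair of small categories, on objects
   and horizontal morphisms (hobcat) and on vertical morphisms and squares
   (hsqcat); level n of the horizontal nerve has the n-chains of the former as
   objects and those of the latter as morphisms. *)
Definition hobcat : smallcat.
Proof.
refine (@SmallCat (ob (d0 D)) (ob (d1 D)) (fob hsrc) (fob htgt) (fob hunit)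
          hcomp_ob _ _ _ _ _ _ _).
- exact: hsrc_unit_ob.
- exact: htgt_unit_ob.
- exact: hsrc_comp_ob.
- exact: htgt_comp_ob.
- exact: hcomp1m_ob.
- exact: hcompm1_ob.
- exact: hcompA_ob.
Defined.

Definition hsqcat : smallcat.
Proof.
refine (@SmallCat (mor (d0 D)) (mor (d1 D)) (fmor hsrc) (fmor htgt)
          (fmor hunit) hcomp_sq _ _ _ _ _ _ _).
- exact: hsrc_unit_sq.
- exact: htgt_unit_sq.
- exact: hsrc_comp_sq.
- exact: htgt_comp_sq.
- exact: hcomp1m_sq.
- exact: hcompm1_sq.
- exact: hcompA_sq.
Defined.

Definition vdom : sfunctor hsqcat hobcat.
Proof.
refine (@SFunctor hsqcat hobcat (@dom (d0 D)) (@dom (d1 D)) _ _ _ _).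
- by move=> f /=; rewrite fdom.
- by move=> f /=; rewrite fdom.
- by move=> f /=; rewrite fdom.
- move=> f g e e'; rewrite /= /hcomp_sq fdom /=.
  by congr (hcomp _); apply: pair_val_eq.
Defined.

Definition vcod : sfunctor hsqcat hobcat.
Proof.
refine (@SFunctor hsqcat hobcat (@cod (d0 D)) (@cod (d1 D)) _ _ _ _).
- by move=> f /=; rewrite fcod.
- by move=> f /=; rewrite fcod.
- by move=> f /=; rewrite fcod.
- move=> f g e e'; rewrite /= /hcomp_sq fcod /=.
  by congr (hcomp _); apply: pair_val_eq.
Defined.

Definition vone : sfunctor hobcat hsqcat.
Proof.
refine (@SFunctor hobcat hsqcat (@one (d0 D)) (@one (d1 D)) _ _ _ _).
- by move=> x /=; rewrite fone.
- by move=> x /=; rewrite fone.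
- by move=> x /=; rewrite fone.
- move=> x y e e'; rewrite /= /hcomp_ob -fone /hcomp_sq.
  by congr (fmor hcomp _); apply: pair_val_eq.
Defined.

Lemma vcomp_eq0 (p : ob (pullback vcod vdom)) :
  @cod (d0 D) (sval p).1 = @dom (d0 D) (sval p).2.
Proof. exact: (svalP p). Qed.

Lemma vcomp_eq1 (p : mor (pullback vcod vdom)) :
  @cod (d1 D) (sval p).1 = @dom (d1 D) (sval p).2.
Proof. exact: (svalP p). Qed.

Definition vcomp : sfunctor (pullback vcod vdom) hsqcat.
Proof.
refine (@SFunctor (pullback vcod vdom) hsqcat
  (fun p => @scomp (d0 D) _ _ (vcomp_eq0 p))
  (fun p => @scomp (d1 D) _ _ (vcomp_eq1 p)) _ _ _ _).
- move=> p /=; have e : cod (fmor hsrc (sval p).1) = dom (fmor hsrc (sval p).2).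
    by rewrite fcod fdom vcomp_eq1.
  by rewrite (fscomp hsrc _ e); apply: scomp_eq.
- move=> p /=; have e : cod (fmor htgt (sval p).1) = dom (fmor htgt (sval p).2).
    by rewrite fcod fdom vcomp_eq1.
  by rewrite (fscomp htgt _ e); apply: scomp_eq.
- move=> p /=; have e : cod (fmor hunit (sval p).1) =
      dom (fmor hunit (sval p).2).
    by rewrite fcod fdom vcomp_eq0.
  by rewrite (fscomp hunit _ e); apply: scomp_eq.
- move=> p q e e'.
  have ep := vcomp_eq1 p; have eq := vcomp_eq1 q.
  have e1 : fmor htgt (sval p).1 = fmor hsrc (sval q).1 := pb_eq1 e.
  have e2 : fmor htgt (sval p).2 = fmor hsrc (sval q).2 := pb_eq2 e.
  pose s := exist (fun z => fmor htgt z.1 = fmor hsrc z.2)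
    ((sval p).1, (sval q).1) e1 : mor (pullback htgt hsrc).
  pose t := exist (fun z => fmor htgt z.1 = fmor hsrc z.2)
    ((sval p).2, (sval q).2) e2 : mor (pullback htgt hsrc).
  have est : cod s = dom t by apply: pair_val_eq.
  have est' : cod (fmor hcomp s) = dom (fmor hcomp t) by rewrite fcod fdom est.
  transitivity (scomp _ _ est').
    by apply: (@scomp_eq (d1 D)); apply: (@hcomp_sq_eq D).
  transitivity (fmor hcomp (scomp _ _ est)); first by rewrite -(fscomp hcomp est).
  by congr (fmor hcomp _); apply: pair_val_eq; apply: scomp_eq.
Defined.

End Transpose.

Section ChainPair.
Variables (A B C : smallcat) (F : sfunctor A C) (G : sfunctor B C) (n : nat).
Variables (x : chain A n) (y : chain B n).
Hypothesis e : chain_map F x = chain_map G y.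

Lemma chain_pair_vtx i : F (vtx x i) = G (vtx y i).
Proof. exact: (congr1 (fun z => vtx z i) e). Qed.

Lemma chain_pair_edge i : fmor F (edge x i) = fmor G (edge y i).
Proof. exact: (congr1 (fun z => edge z i) e). Qed.

Definition chain_pair : chain (pullback F G) n.
Proof.
refine (@Chain (pullback F G) n
  (fun i => exist _ (vtx x i, vtx y i) (chain_pair_vtx i))
  (fun i => exist _ (edge x i, edge y i) (chain_pair_edge i)) _ _) => i.
- by apply: pair_val_eq; apply: dom_edge.
- by apply: pair_val_eq; apply: cod_edge.
Defined.

End ChainPair.

(* The n-fold fibre product d1 D x_{d0 D} ... x_{d0 D} d1 D, with the
   componentwise vertical structure. *)
Definition hnerve_cat (D : dblcat) (n : nat) : smallcat.
Proof.
refine (@SmallCat (chain (hobcat D) n) (chain (hsqcat D) n)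
  (chain_map (vdom D)) (chain_map (vcod D)) (chain_map (vone D))
  (fun f g e => chain_map (vcomp D) (chain_pair e)) _ _ _ _ _ _ _).
- by move=> x; apply: chain_eq => i /=;
    [exact: (@dom_one (d0 D))|exact: (@dom_one (d1 D))].
- by move=> x; apply: chain_eq => i /=;
    [exact: (@cod_one (d0 D))|exact: (@cod_one (d1 D))].
- by move=> f g e; apply: chain_eq => i /=;
    [exact: (@dom_scomp (d0 D))|exact: (@dom_scomp (d1 D))].
- by move=> f g e; apply: chain_eq => i /=;
    [exact: (@cod_scomp (d0 D))|exact: (@cod_scomp (d1 D))].
- by move=> f e; apply: chain_eq => i /=;
    [exact: (@scomp1m (d0 D))|exact: (@scomp1m (d1 D))].
- by move=> f e; apply: chain_eq => i /=;
    [exact: (@scompm1 (d0 D))|exact: (@scompm1 (d1 D))].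
- by move=> f g h efg egh el er; apply: chain_eq => i /=;
    [exact: (@scompA (d0 D))|exact: (@scompA (d1 D))].
Defined.

Definition hnerve_act (D : dblcat) m n (a : monotone m n) :
  sfunctor (hnerve_cat D n) (hnerve_cat D m).
Proof.
refine (@SFunctor (hnerve_cat D n) (hnerve_cat D m)
          (chain_act a) (chain_act a) _ _ _ _).
- by move=> f /=; rewrite chain_map_act.
- by move=> f /=; rewrite chain_map_act.
- by move=> f /=; rewrite chain_map_act.
- move=> f g e e' /=; rewrite chain_map_act; congr (chain_map (vcomp D) _).
  apply: chain_eq => i; apply: pair_val_eq => //=.
  + have ef : chain_map (pb_fst _ _) (chain_pair e) = f by apply: chain_eq.
    by rewrite -[in RHS]ef thru_map.
  + have eg : chain_map (pb_snd _ _) (chain_pair e) = g by apply: chain_eq.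
    by rewrite -[in RHS]eg thru_map.
Defined.

Definition hnerve_obj (D : dblcat) : obj SCat.
Proof.
refine (@Functor (opposite Delta) Cat (hnerve_cat D)
          (fun n m a => hnerve_act D a) _ _).
- by move=> n; apply: sfunctor_eq => x; apply: chain_act_id.
- by move=> m n p a b; apply: sfunctor_eq => x; apply: chain_act_comp.
Defined.

Section HnerveHom.
Variables (D E : dblcat) (F : dblfunctor D E).

Definition hobfun : sfunctor (hobcat D) (hobcat E).
Proof.
refine (@SFunctor (hobcat D) (hobcat E) (df0 F) (df1 F) _ _ _ _).
- exact: df_src_ob.
- exact: df_tgt_ob.
- exact: df_unit_ob.
- by move=> f g e e'; apply: df_comp_ob.
Defined.

Definition hsqfun : sfunctor (hsqcat D) (hsqcat E).
Proof.
refine (@SFunctor (hsqcat D) (hsqcat E) (fmor (df0 F)) (fmor (df1 F)) _ _ _ _).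
- exact: df_src_sq.
- exact: df_tgt_sq.
- exact: df_unit_sq.
- by move=> f g e e'; apply: df_comp_sq.
Defined.

Definition hnerve_map (n : nat) : sfunctor (hnerve_cat D n) (hnerve_cat E n).
Proof.
refine (@SFunctor (hnerve_cat D n) (hnerve_cat E n)
          (chain_map hobfun (n := n)) (chain_map hsqfun (n := n)) _ _ _ _).
- by move=> f; apply: chain_eq => i;
    [exact: (fdom (df0 F))|exact: (fdom (df1 F))].
- by move=> f; apply: chain_eq => i;
    [exact: (fcod (df0 F))|exact: (fcod (df1 F))].
- by move=> x; apply: chain_eq => i;
    [exact: (fone (df0 F))|exact: (fone (df1 F))].
- by move=> f g e e'; apply: chain_eq => i;
    [exact: (fscomp (df0 F))|exact: (fscomp (df1 F))].
Defined.

Definition hnerve_hom : nattrans (hnerve_obj D) (hnerve_obj E).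
Proof.
exists hnerve_map => m n a.
by apply: sfunctor_eq => x; rewrite /= chain_map_act.
Defined.

End HnerveHom.

Definition hnerve : functor DblCat SCat.
Proof.
refine (@Functor DblCat SCat hnerve_obj hnerve_hom _ _).
- by move=> D; apply: nattrans_eq => n; apply: sfunctor_eq => x;
    apply: chain_eq.
- by move=> D E K F G; apply: nattrans_eq => n; apply: sfunctor_eq => x;
    apply: chain_eq.
Defined.

Definition chain0 (C : smallcat) (x : ob C) : chain C 0.
Proof.
by refine (@Chain C 0 (fun _ => x)
             (fun i => match notF (ltn_ord i) with end) _ _) => - [].
Defined.

Definition chain1 (C : smallcat) (f : mor C) : chain C 1.
Proof.
by refine (@Chain C 1 (fun i => if val i is 0 then dom f else cod f)
             (fun _ => f) _ _) => - [[|?] ?].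
Defined.

Lemma chain0K (C : smallcat) (x : chain C 0) : chain0 (vtx x ord0) = x.
Proof. by apply: chain_eq => [i|[]] //=; rewrite (ord1 i). Qed.

Lemma chain1K (C : smallcat) (x : chain C 1) : chain1 (edge x ord0) = x.
Proof.
apply: chain_eq => [i|i] /=; last by rewrite (ord1 i).
case: i => [[|[|?]] ?] //=; rewrite ?dom_edge ?cod_edge;
  by congr vtx; apply: val_inj.
Qed.

Section HnerveLow.
Variable D : dblcat.

Definition hnerve0_to : sfunctor (hnerve_cat D 0) (d0 D).
Proof.
refine (@SFunctor (hnerve_cat D 0) (d0 D)
  (fun x => vtx x ord0) (fun x => vtx x ord0) _ _ _ _) => //=.
by move=> f g e e'; apply: (@scomp_eq (d0 D)).
Defined.

Definition hnerve0_from : sfunctor (d0 D) (hnerve_cat D 0).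
Proof.
refine (@SFunctor (d0 D) (hnerve_cat D 0)
  (fun x => @chain0 (hobcat D) x) (fun x => @chain0 (hsqcat D) x) _ _ _ _).
- by move=> x; apply: chain_eq => // - [].
- by move=> x; apply: chain_eq => // - [].
- by move=> x; apply: chain_eq => // - [].
- move=> f g e e'; apply: chain_eq => [i|[]] //.
  by apply: (@scomp_eq (d0 D)).
Defined.

Lemma hnerve_level0 : @isomorphic Cat (hnerve D 0) (d0 D).
Proof.
exists hnerve0_to, hnerve0_from; split; apply: sfunctor_eq => x //=;
  exact: chain0K.
Qed.

Definition hnerve1_to : sfunctor (hnerve_cat D 1) (d1 D).
Proof.
refine (@SFunctor (hnerve_cat D 1) (d1 D)
  (fun x => edge x ord0) (fun x => edge x ord0) _ _ _ _) => //=.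
by move=> f g e e'; apply: (@scomp_eq (d1 D)).
Defined.

Definition hnerve1_from : sfunctor (d1 D) (hnerve_cat D 1).
Proof.
refine (@SFunctor (d1 D) (hnerve_cat D 1)
  (fun x => @chain1 (hobcat D) x) (fun x => @chain1 (hsqcat D) x) _ _ _ _).
- move=> x; apply: chain_eq => // - [[|?] ?] /=; by rewrite fdom.
- move=> x; apply: chain_eq => // - [[|?] ?] /=; by rewrite fcod.
- move=> x; apply: chain_eq => // - [[|?] ?] /=; by rewrite fone.
- move=> f g e e'; apply: chain_eq => i; last by apply: (@scomp_eq (d1 D)).
  case: i => [[|?] ?] /=.
  + have h : cod (fmor hsrc f) = dom (fmor hsrc g) by rewrite fcod fdom e.
    by rewrite (fscomp hsrc _ h); apply: (@scomp_eq (d0 D)).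
  + have h : cod (fmor htgt f) = dom (fmor htgt g) by rewrite fcod fdom e.
    by rewrite (fscomp htgt _ h); apply: (@scomp_eq (d0 D)).
Defined.

Lemma hnerve_level1 : @isomorphic Cat (hnerve D 1) (d1 D).
Proof.
exists hnerve1_to, hnerve1_from; split; apply: sfunctor_eq => x //=;
  exact: chain1K.
Qed.

End HnerveLow.

Section Boxtimes.
Variables (A B : smallcat).

(* The morphisms of a discrete category are its objects, so a vertical
   morphism is a pair (f, b) and a square is a pair (f, g). *)
Definition box0 : smallcat := product A (discrete (ob B)).

Definition box1 : smallcat := product A (discrete (mor B)).

Definition box_src : sfunctor box1 box0 :=
  product_map (sfunctor_id A) (discrete_map (@dom B)).
Definition box_tgt : sfunctor box1 box0 :=
  product_map (sfunctor_id A) (discrete_map (@cod B)).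
Definition box_unit : sfunctor box0 box1 :=
  product_map (sfunctor_id A) (discrete_map (@one B)).

Lemma box_comp_ob_eq (p : ob (pullback box_tgt box_src)) :
  @cod B (sval p).1.2 = @dom B (sval p).2.2.
Proof. exact: (congr1 snd (svalP p)). Qed.

Lemma box_comp_sq_eq (p : mor (pullback box_tgt box_src)) :
  @cod B (sval p).1.2 = @dom B (sval p).2.2.
Proof. exact: (congr1 snd (svalP p)). Qed.

Definition box_comp : sfunctor (pullback box_tgt box_src) box1.
Proof.
refine (@SFunctor (pullback box_tgt box_src) box1
  (fun p => ((sval p).1.1, @scomp B _ _ (box_comp_ob_eq p)))
  (fun p => ((sval p).1.1, @scomp B _ _ (box_comp_sq_eq p))) _ _ _ _).
- by move=> p; congr pair; apply: (@scomp_eq B).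
- by move=> p; congr pair; apply: (@scomp_eq B).
- by move=> p; congr pair; apply: (@scomp_eq B).
- move=> p q e e'; congr pair; first exact: (@scomp_eq A).
  exact: (@scomp_eq B).
Defined.

Definition boxtimes : dblcat.
Proof.
refine (@DblCat_ box0 box1 box_src box_tgt box_unit box_comp
          _ _ _ _ _ _ _ _ _ _ _ _).
- by apply: sfunctor_eq; case=> a b /=; rewrite dom_one.
- by apply: sfunctor_eq; case=> a b /=; rewrite cod_one.
- by move=> x y e; congr pair; exact: (@dom_scomp B).
- by move=> x y e; congr pair; exact: (@dom_scomp B).
- move=> x y e /=; congr pair; last exact: (@cod_scomp B).
  exact: (congr1 fst e).
- move=> x y e /=; congr pair; last exact: (@cod_scomp B).
  exact: (congr1 fst e).
- by case=> a g e; congr pair; exact: (@scomp1m B).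
- by case=> a g e; congr pair; exact: (@scomp1m B).
- by case=> a g e; congr pair; exact: (@scompm1 B).
- by case=> a g e; congr pair; exact: (@scompm1 B).
- by move=> x y z exy eyz el er; congr pair; exact: (@scompA B).
- by move=> x y z exy eyz el er; congr pair; exact: (@scompA B).
Defined.

End Boxtimes.

(* Main.v *)
From mathcomp Require Import all_boot.
Require Import Defs.
From Stdlib Require Import FunctionalExtensionality.

Set Implicit Arguments.
Unset Strict Implicit.
Unset Printing Implicit Defensive.

(* It suffices to exhibit a universal arrow from [sigma A x nu Y] to the
   horizontal nerve, with target [A boxtimes cY].  The horizontal nerve of [D]
   is levelwise the nerve of [hobcat D] on objects and of [hsqcat D] on
   morphisms.  So a map [sigma A x nu Y -> N_h D] is a family of simplicial maps
   [Y -> N (hobcat D)], one for each object of [A], and [Y -> N (hsqcat D)], one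
   for each morphism of [A], compatible with the vertical structure.
   Transposing along [c -| N] gives functors from [cY] to [hobcat D] and
   [hsqcat D] with the same compatibilities, and such a family is a double
   functor [A boxtimes cY -> D]. *)

(** * Universal arrows and the uniqueness of their targets *)

Record universal_arrow (C D : category) (R : functor D C) (X : obj C)
    (Z : obj D) (u : hom X (R Z)) := UniversalArrow {
  factor : forall W, hom X (R W) -> hom Z W;
  factorP : forall W (f : hom X (R W)), comp u (fhom R (factor f)) = f;
  factor_inj : forall W (g g' : hom Z W),
    comp u (fhom R g) = comp u (fhom R g') -> g = g'
}.

Lemma unit_factor (C D : category) (L : functor C D) (R : functor D C)
    (adj : adjunction L R) (X : obj C) W (g : hom (L X) W) :
  comp (transpose adj (idm (L X))) (fhom R g) = transpose adj g.
Proof. by rewrite -transpose_natr comp1m. Qed.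

Definition unit_universal (C D : category) (L : functor C D) (R : functor D C)
    (adj : adjunction L R) (X : obj C) :
  universal_arrow (transpose adj (idm (L X))).
Proof.
exists (fun W f => untranspose adj f) => [W f | W g g'].
  by rewrite unit_factor untransposeK.
rewrite !unit_factor; exact: can_inj (@transposeK _ _ _ _ adj X W) _ _.
Defined.

(** Each arrow factors through the other; both round trips agree with the identity after the
    universal arrow, so [factor_inj] applies. *)
Lemma universal_arrow_iso (C D : category) (R : functor D C) (X : obj C)
    (Z Z' : obj D) (u : hom X (R Z)) (u' : hom X (R Z')) :
  universal_arrow u -> universal_arrow u' -> isomorphic Z Z'.
Proof.
move=> U U'; exists (factor U u'), (factor U' u).
by split; [apply: (factor_inj U) | apply: (factor_inj U')];
  rewrite fhomM -compA !factorP fhom1 compm1.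
Qed.

Section NerveArrow.
Variables (Y : obj SSet) (B : smallcat) (u : nattrans Y (nerve_obj B)).
Hypothesis U : @universal_arrow SSet Cat nerve Y B u.

Lemma nerve_factorP (C : smallcat) (s : nattrans Y (nerve_obj C)) n y :
  chain_map (factor U s) (u n y) = s n y.
Proof.
exact: (congr1 (fun t : nattrans Y (nerve_obj C) => t n y) (factorP U s)).
Qed.

(** Reduces equations between functors out of [B] to the simplices of [Y]; the compatibilities of
    transposed functors are all checked this way. *)
Lemma nerve_factor_inj (C : smallcat) (F G : sfunctor B C) :
  (forall n y, chain_map F (u n y) = chain_map G (u n y)) -> F = G.
Proof.
move=> FG; apply: (factor_inj U); apply: nattrans_eq => n.
by apply: functional_extensionality => y; apply: FG.
Qed.

End NerveArrow.

Section PullbackPair.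
Variables (A B C E : smallcat) (F : sfunctor A C) (G : sfunctor B C).
Variables (H : sfunctor E A) (K : sfunctor E B).
Hypothesis HK : sfunctor_comp H F = sfunctor_comp K G.

Lemma pb_pair_ob x : F (H x) = G (K x).
Proof. exact: (congr1 (fun J : sfunctor _ _ => J x) HK). Qed.

Lemma pb_pair_mor f : fmor F (fmor H f) = fmor G (fmor K f).
Proof. exact: (congr1 (fun J => fmor J f) HK). Qed.

(** Followed by [vcomp D], this expresses the pointwise vertical composite of two functors into
    [hsqcat D]. *)
Definition pb_pair : sfunctor E (pullback F G).
Proof.
refine (@SFunctor E (pullback F G)
  (fun x => exist _ (H x, K x) (pb_pair_ob x))
  (fun f => exist _ (fmor H f, fmor K f) (pb_pair_mor f)) _ _ _ _).
- by move=> f; apply: pair_val_eq; apply: fdom.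
- by move=> f; apply: pair_val_eq; apply: fcod.
- by move=> x; apply: pair_val_eq; apply: fone.
- by move=> f g e e'; apply: pair_val_eq; apply: fscomp.
Defined.

End PullbackPair.

(** * Double functors out of an external product *)

Section BoxFunctor.
Variables (A B : smallcat) (D : dblcat).
Variables (Fob : ob A -> sfunctor B (hobcat D)).
Variables (Fsq : mor A -> sfunctor B (hsqcat D)).
(** The four hypotheses make [Fob] and [Fsq] a functor from [A] to the category with objects the
    functors from [B] to [hobcat D] and morphisms the functors from [B] to [hsqcat D]. *)
Hypothesis Fdom : forall f, sfunctor_comp (Fsq f) (vdom D) = Fob (dom f).
Hypothesis Fcod : forall f, sfunctor_comp (Fsq f) (vcod D) = Fob (cod f).
Hypothesis Fone : forall a, Fsq (one a) = sfunctor_comp (Fob a) (vone D).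
Hypothesis Fscomp : forall f g (e : cod f = dom g)
  (E : sfunctor_comp (Fsq f) (vcod D) = sfunctor_comp (Fsq g) (vdom D)),
  Fsq (scomp f g e) = sfunctor_comp (pb_pair E) (vcomp D).

Lemma box_functor_joint f g :
  cod f = dom g ->
  sfunctor_comp (Fsq f) (vcod D) = sfunctor_comp (Fsq g) (vdom D).
Proof. by move=> e; rewrite Fcod Fdom e. Qed.

Definition box_functor0 : sfunctor (box0 A B) (d0 D).
Proof.
refine (@SFunctor (box0 A B) (d0 D) (fun p => Fob p.1 p.2)
          (fun p => Fsq p.1 p.2) _ _ _ _).
- by case=> f x /=; rewrite -Fdom.
- by case=> f x /=; rewrite -Fcod.
- by case=> a x /=; rewrite Fone.
(* The second factor is discrete, so composable arrows share [x], and the claim is [Fscomp]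
   evaluated at [x]. *)
- case=> f x [g x'] e e' /=; have [e1 e2] := e; rewrite /= in e2; subst x'.
  rewrite (Fscomp _ (box_functor_joint e1)) /=.
  by apply: (@scomp_eq (d0 D)).
Defined.

Definition box_functor1 : sfunctor (box1 A B) (d1 D).
Proof.
refine (@SFunctor (box1 A B) (d1 D) (fun p => fmor (Fob p.1) p.2)
          (fun p => fmor (Fsq p.1) p.2) _ _ _ _).
- by case=> f x /=; rewrite -Fdom.
- by case=> f x /=; rewrite -Fcod.
- by case=> a x /=; rewrite Fone.
- case=> f x [g x'] e e' /=; have [e1 e2] := e; rewrite /= in e2; subst x'.
  rewrite (Fscomp _ (box_functor_joint e1)) /=.
  by apply: (@scomp_eq (d1 D)).
Defined.

Definition box_functor : dblfunctor (boxtimes A B) D.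
Proof.
refine (@DblFunctor (boxtimes A B) D box_functor0 box_functor1 _ _ _ _ _).
- by apply: sfunctor_eq; case=> a g;
    [exact: (fdom (Fob a)) | exact: (fdom (Fsq a))].
- by apply: sfunctor_eq; case=> a g;
    [exact: (fcod (Fob a)) | exact: (fcod (Fsq a))].
- by apply: sfunctor_eq; case=> a g;
    [exact: (fone (Fob a)) | exact: (fone (Fsq a))].
(* Horizontally composable arrows share their [A] component, which leaves functoriality in [B]. *)
- case=> a g [a' g'] e e'; have [ea _] := e; rewrite /= in ea; subst a'.
  exact: (fscomp (Fob a)).
- case=> a g [a' g'] e e'; have [ea _] := e; rewrite /= in ea; subst a'.
  exact: (fscomp (Fsq a)).
Defined.

End BoxFunctor.

(** * The universal arrow into the horizontal nerve of the external product *)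

Section BoxArrow.
Variables (A B : smallcat).

Definition box_ob_at (a : ob A) : sfunctor B (hobcat (boxtimes A B)).
Proof.
refine (@SFunctor B (hobcat (boxtimes A B)) (fun x => (a, x))
          (fun g => (a, g)) _ _ _ _) => //.
by move=> f g e e'; congr pair; apply: (@scomp_eq B).
Defined.

Definition box_sq_at (f : mor A) : sfunctor B (hsqcat (boxtimes A B)).
Proof.
refine (@SFunctor B (hsqcat (boxtimes A B)) (fun x => (f, x))
          (fun g => (f, g)) _ _ _ _) => //.
by move=> g h e e'; congr pair; apply: (@scomp_eq B).
Defined.

Variables (Y : obj SSet) (u : nattrans Y (nerve_obj B)).

Definition box_arrow_level n :
  sfunctor (product A (discrete (Y n))) (hnerve_cat (boxtimes A B) n).
Proof.
refine (@SFunctor (product A (discrete (Y n))) (hnerve_cat (boxtimes A B) n)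
  (fun p => chain_map (box_ob_at p.1) (u n p.2))
  (fun p => chain_map (box_sq_at p.1) (u n p.2)) _ _ _ _).
- by move=> p; apply: chain_eq.
- by move=> p; apply: chain_eq.
- by move=> p; apply: chain_eq.
- case=> f y [g y'] e e'; have [_ ey] := e; rewrite /= in ey; subst y'.
  by apply: chain_eq => i; congr pair; apply: (@scomp_eq A).
Defined.

Definition box_arrow :
  nattrans (sproduct (sigma A) (nu Y)) (hnerve_obj (boxtimes A B)).
Proof.
(* Since [sigma A] is constant, only the naturality of [u] is at stake. *)
exists box_arrow_level => m n a; apply: sfunctor_eq => -[z y] /=;
  rewrite chain_map_act; congr chain_map;
  exact: (congr1 (fun h => h y) (ntP u a)).
Defined.

Section Factor.
Variables (D : dblcat).
Variable t : nattrans (sproduct (sigma A) (nu Y)) (hnerve_obj D).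

Definition hob_restr (a : ob A) : nattrans Y (nerve_obj (hobcat D)).
Proof.
exists (fun n y => t n (a, y)) => m n b; apply: functional_extensionality => y.
exact: (congr1 (fun H : sfunctor (product A (discrete (Y m))) (hnerve_cat D n)
                => H (a, y)) (ntP t b)).
Defined.

Definition hsq_restr (f : mor A) : nattrans Y (nerve_obj (hsqcat D)).
Proof.
exists (fun n y => fmor (t n) (f, y)) => m n b.
apply: functional_extensionality => y.
exact: (congr1 (fun H : sfunctor (product A (discrete (Y m))) (hnerve_cat D n)
                => fmor H (f, y)) (ntP t b)).
Defined.

Hypothesis U : @universal_arrow SSet Cat nerve Y B u.

Definition hob_factor (a : ob A) : sfunctor B (hobcat D) :=
  factor U (hob_restr a).
Definition hsq_factor (f : mor A) : sfunctor B (hsqcat D) :=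
  factor U (hsq_restr f).

Lemma chain_map_hob_factor a n y :
  chain_map (hob_factor a) (u n y) = t n (a, y).
Proof. exact: (nerve_factorP U (hob_restr a)). Qed.

Lemma chain_map_hsq_factor f n y :
  chain_map (hsq_factor f) (u n y) = fmor (t n) (f, y).
Proof. exact: (nerve_factorP U (hsq_restr f)). Qed.

Lemma chain_map_comp (C E K : smallcat) (F : sfunctor C E) (G : sfunctor E K) n
    (x : chain C n) :
  chain_map (sfunctor_comp F G) x = chain_map G (chain_map F x).
Proof. exact: chain_eq. Qed.

(** On the simplex [y] this is the domain law of the functor [t n] at [(f, y)]; the next three
    lemmas use its other laws likewise. *)
Lemma factor_dom f : sfunctor_comp (hsq_factor f) (vdom D) = hob_factor (dom f).
Proof.
apply: (nerve_factor_inj U) => n y.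
rewrite chain_map_comp chain_map_hob_factor chain_map_hsq_factor.
exact: (fdom (t n) (f, y)).
Qed.

Lemma factor_cod f : sfunctor_comp (hsq_factor f) (vcod D) = hob_factor (cod f).
Proof.
apply: (nerve_factor_inj U) => n y.
rewrite chain_map_comp chain_map_hob_factor chain_map_hsq_factor.
exact: (fcod (t n) (f, y)).
Qed.

Lemma factor_one a : hsq_factor (one a) = sfunctor_comp (hob_factor a) (vone D).
Proof.
apply: (nerve_factor_inj U) => n y.
rewrite chain_map_comp chain_map_hob_factor chain_map_hsq_factor.
exact: (fone (t n) (a, y)).
Qed.

Lemma factor_scomp f g (e : cod f = dom g)
    (E : sfunctor_comp (hsq_factor f) (vcod D) =
         sfunctor_comp (hsq_factor g) (vdom D)) :
  hsq_factor (scomp f g e) = sfunctor_comp (pb_pair E) (vcomp D).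
Proof.
apply: (nerve_factor_inj U) => n y.
rewrite chain_map_comp chain_map_hsq_factor.
(* In [discrete (Y n)] the identity of [y] is [y] itself, so [p f] and [p g] are composable. *)
pose p h : mor (product A (discrete (Y n))) := (h, y).
have ep : cod (p f) = dom (p g) by rewrite /= e.
have et : cod (fmor (t n) (p f)) = dom (fmor (t n) (p g)).
  by rewrite fcod fdom ep.
transitivity (scomp _ _ et).
  rewrite -(fscomp (t n) ep); congr (fmor (t n) _).
  by congr pair; apply: scomp_eq.
congr (chain_map (vcomp D)).
by apply: chain_eq => i; apply: pair_val_eq;
  rewrite /= -chain_map_hsq_factor.
Qed.

Definition box_factor : dblfunctor (boxtimes A B) D :=
  box_functor factor_dom factor_cod factor_one factor_scomp.

End Factor.

Lemma box_arrow_hom_inj (U : @universal_arrow SSet Cat nerve Y B u)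
    (D : dblcat) (G G' : dblfunctor (boxtimes A B) D) :
  comp (c := SCat) box_arrow (hnerve_hom G) =
    comp (c := SCat) box_arrow (hnerve_hom G') -> G = G'.
Proof.
move=> GG'.
pose S := nattrans (sproduct (sigma A) (nu Y)) (hnerve_obj D).
pose level (s : S) n : sfunctor (product A (discrete (Y n))) (hnerve_cat D n) :=
  s n.
have eob a : sfunctor_comp (box_ob_at a) (hobfun G) =
             sfunctor_comp (box_ob_at a) (hobfun G').
  apply: (nerve_factor_inj U) => n y; rewrite !chain_map_comp.
  exact: (congr1 (fun s : S => fob (level s n) (a, y)) GG').
have esq f : sfunctor_comp (box_sq_at f) (hsqfun G) =
             sfunctor_comp (box_sq_at f) (hsqfun G').
  apply: (nerve_factor_inj U) => n y; rewrite !chain_map_comp.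
  exact: (congr1 (fun s : S => fmor (level s n) (f, y)) GG').
(* The goals concern, in order, objects, vertical morphisms, horizontal morphisms and squares; each
   is a value of a slice at [z]. *)
apply: dblfunctor_eq; apply: sfunctor_eq => -[z x].
- exact: (congr1 (fun F : sfunctor B (hobcat D) => F x) (eob z)).
- exact: (congr1 (fun F : sfunctor B (hsqcat D) => F x) (esq z)).
- exact: (congr1 (fun F : sfunctor B (hobcat D) => fmor F x) (eob z)).
- exact: (congr1 (fun F : sfunctor B (hsqcat D) => fmor F x) (esq z)).
Qed.

Definition box_arrow_universal (U : @universal_arrow SSet Cat nerve Y B u) :
  @universal_arrow SCat DblCat hnerve (sproduct (sigma A) (nu Y))
    (boxtimes A B) box_arrow.
Proof.
exists (fun D t => box_factor t U) => [D t|]; last exact: box_arrow_hom_inj.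
apply: nattrans_eq => n; apply: sfunctor_eq => -[z y].
- rewrite -(chain_map_hob_factor t U); exact: chain_eq.
- rewrite -(chain_map_hsq_factor t U); exact: chain_eq.
Defined.

End BoxArrow.

(* c_h and c range over arbitrary left adjoints of the horizontal nerve and of
   the nerve; a left adjoint is unique up to isomorphism. *)
Theorem proposition6p11
  (c_h : functor SCat DblCat) (c_h_adj : adjunction c_h hnerve)
  (c : functor SSet Cat) (c_adj : adjunction c nerve)
  (A : smallcat) (Y : obj SSet) :
  @isomorphic DblCat (c_h (sproduct (sigma A) (nu Y))) (boxtimes A (c Y)).
Proof.
apply: universal_arrow_iso.
  exact: (unit_universal c_h_adj).
exact: (box_arrow_universal A (unit_universal c_adj Y)).
Qed.
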